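(* Let $n\ge1$ and let $\mathcal{P}_n$ be the set of all integer partitions of length at most $n$. Each of the families $(\mathrm{sz}^{(n)}_\lambda)_{\lambda\in\mathcal{P}_n}$, $(\mathrm{spz}^{(n)}_\lambda)_{\lambda\in\mathcal{P}_n}$, $(\mathrm{oz}^{(n)}_\lambda)_{\lambda\in\mathcal{P}_n}$, $(\mathrm{sz}^{\mathrm{odd},(n)}_\lambda)_{\lambda\in\mathcal{P}_n}$, $(\mathrm{spz}^{\mathrm{odd},(n)}_\lambda)_{\lambda\in\mathcal{P}_n}$, $(\mathrm{oz}^{\mathrm{odd},(n)}_\lambda)_{\lambda\in\mathcal{P}_n}$ is a basis of the vector space $\operatorname{Sym}_n$.
   Context: $\operatorname{Sym}_N$ is the algebra of symmetric polynomials in $N$ variables over $\mathbb{C}$. For $P\in\operatorname{Sym}_{2n}$, $\Phi_n(P)$ is the unique $Q\in\operatorname{Sym}_n$ with $P(x_1,\ldots,x_n,x_1^{-1},\ldots,x_n^{-1})=Q(x_1+x_1^{-1},\ldots,x_n+x_n^{-1})$; for $P\in\operatorname{Sym}_{2n+1}$, $\Phi_n^{\mathrm{odd}}(P)$ is the unique $Q\in\operatorname{Sym}_n$ with $P(x_1,\ldots,x_n,x_1^{-1},\ldots,x_n^{-1},1)=Q(x_1+x_1^{-1},\ldots,x_n+x_n^{-1})$ (existence and uniqueness hold). $\mathrm{s}_\lambda$ is the Schur function. Let $\mathrm{h}_k$ be the complete homogeneous symmetric functions ($\mathrm{h}_0=1$, $\mathrm{h}_k=0$ for $k<0$). For a nonempty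 partition $\lambda$ of length $\ell(\lambda)$, \[ \mathrm{sp}_\lambda=\tfrac12\det\bigl[\mathrm{h}_{\lambda_j-j+k}+\mathrm{h}_{\lambda_j-j-k+2}\bigr]_{j,k=1}^{\ell(\lambda)},\qquad \mathrm{o}_\lambda=\det\bigl[\mathrm{h}_{\lambda_j-j+k}-\mathrm{h}_{\lambda_j-j-k}\bigr]_{j,k=1}^{\ell(\lambda)}, \] and $\mathrm{sp}_\varnothing=\mathrm{o}_\varnothing=1$. For a symmetric function, the superscript $(N)$ denotes its restriction to $N$ variables. Put $\mathrm{sz}^{(n)}_\lambda=\Phi_n(\mathrm{s}^{(2n)}_\lambda)$, $\mathrm{spz}^{(n)}_\lambda=\Phi_n(\mathrm{sp}^{(2n)}_\lambda)$, $\mathrm{oz}^{(n)}_\lambda=\Phi_n(\mathrm{o}^{(2n)}_\lambda)$, $\mathrm{sz}^{\mathrm{odd},(n)}_\lambda=\Phi^{\mathrm{odd}}_n(\mathrm{s}^{(2n+1)}_\lambda)$, $\mathrm{spz}^{\mathrm{odd},(n)}_\lambda=\Phi^{\mathrm{odd}}_n(\mathrm{sp}^{(2n+1)}_\lambda)$, $\mathrm{oz}^{\mathrm{odd},(n)}_\lambda=\Phi^{\mathrm{odd}}_n(\mathrm{o}^{(2n+1)}_\lambda)$. *)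

(* Defs.v *)
From HB Require Import structures.
From mathcomp Require Import all_boot all_order all_algebra.
From mathcomp Require Import complex mpoly.
From mathcomp Require Import classical_sets reals.
From mathcomp Require Import zify ring.

Set Implicit Arguments.
Unset Strict Implicit.
Unset Printing Implicit Defensive.

Import GRing.Theory.

Local Open Scope ring_scope.

Definition is_partition (lam : seq nat) : bool :=
  sorted geq lam && (0%N \notin lam).

(* Partitions of length at most n, stored without trailing zeros, so that
   [size lam] is the length of [lam] and each partition occurs once. *)
Record Par (n : nat) := MkPar {
  par_val :> seq nat;
  par_valP : is_partition par_val && (size par_val <= n)%N
}.

HB.instance Definition _ n := [isSub for @par_val n].
HB.instance Definition _ n := [Choice of Par n by <:].

(* The family v is a basis of the subspace S of V: it lies in S, it is
   linearly independent, and it spans S.  The index type may be infinite, so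
   linear combinations run over duplicate-free finite lists of indices. *)
Definition is_basis (K : fieldType) (V : lmodType K) (I : choiceType)
    (S : {pred V}) (v : I -> V) : Prop :=
  [/\ forall i, v i \in S,
      forall (s : seq I) (c : I -> K), uniq s ->
        \sum_(i <- s) c i *: v i = 0 -> {in s, forall i, c i = 0}
    & forall x : V, x \in S ->
        exists (s : seq I) (c : I -> K),
          uniq s /\ x = \sum_(i <- s) c i *: v i ].

Section SchurFunctions.
Variables (K : fieldType) (N : nat).

(* Sum of all monomials of degree k; the index type, the monomials of degree
   less than k + 1, only serves to make the sum finite. *)
Definition hsym (k : nat) : {mpoly K[N]} :=
  \sum_(m : 'X_{1..N < k.+1} | mdeg m == k) 'X_[m].

Definition hsymz (k : int) : {mpoly K[N]} :=
  if k is Posz m then hsym m else 0.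

(* In the determinants below [j.+1] and [k.+1] are the usual row and column
   indices, which start at 1. *)

(* Jacobi-Trudi formula; see [schur_bialternant] below. *)
Definition schur (lam : seq nat) : {mpoly K[N]} :=
  \det (\matrix_(j < size lam, k < size lam)
          hsymz ((nth 0%N lam j)%:Z - j.+1%:Z + k.+1%:Z)).

Definition schur_sp (lam : seq nat) : {mpoly K[N]} :=
  if lam is [::] then 1 else
  2%:R^-1 *: \det (\matrix_(j < size lam, k < size lam)
    (hsymz ((nth 0%N lam j)%:Z - j.+1%:Z + k.+1%:Z)
     + hsymz ((nth 0%N lam j)%:Z - j.+1%:Z - k.+1%:Z + 2%:Z))).

Definition schur_o (lam : seq nat) : {mpoly K[N]} :=
  \det (\matrix_(j < size lam, k < size lam)
    (hsymz ((nth 0%N lam j)%:Z - j.+1%:Z + k.+1%:Z)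
     - hsymz ((nth 0%N lam j)%:Z - j.+1%:Z - k.+1%:Z))).

End SchurFunctions.

Section Bialternant.
Variables (K : fieldType) (N : nat).
Local Notation A := {mpoly K[N]}.
Local Notation h := (hsym K N).
Local Notation hz := (hsymz K N).

(* The truncation to degree at most b of the generating series of the h_k. *)
Let geom (b : nat) (x : A) : {poly A} := \sum_(k < b.+1) (x ^+ k)%:P * 'X^k.
Let xp (i : 'I_N) : A := 'X_i.

Let hsym_coef (a b : nat) : (b <= a)%N ->
  (\prod_(i < N) geom a (xp i))`_b = h b.
Proof.
move=> leba; rewrite /geom bigA_distr_bigA /= coef_sum /hsym.
under eq_bigr => f _.
  rewrite big_split /= -rmorph_prod /= (eq_bigr (fun i => 'X^(f i))) //.
  rewrite prodrXr coefCM coefXn mulr_natr mulrb eq_sym.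
  over.
rewrite -big_mkcond /= /xp.
pose f2m (f : {ffun 'I_N -> 'I_a.+1}) : 'X_{1..N} := [multinom (f i : nat) | i < N].
have degf f : mdeg (f2m f) = (\sum_i (f i : nat))%N.
  by rewrite mdegE; apply: eq_bigr => i _; rewrite mnmE.
rewrite [RHS](reindex_onto (fun f => insubd (BMultinom (bm0_proof N b)) (f2m f))
   (fun m : 'X_{1..N < b.+1} => [ffun i => inord ((m : 'X_{1..N}) i)])) /=; last first.
  move=> m /eqP dm; apply/val_inj; rewrite val_insubd /=.
  have E : f2m [ffun i => inord ((m : 'X_{1..N}) i)] = m :> 'X_{1..N}.
    apply/mnmP=> i; rewrite mnmE ffunE inordK // ltnS (leq_trans _ leba) //.
    apply: (@leq_trans (mdeg m)); last by rewrite dm.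
    by rewrite mdegE (bigD1 i) //= leq_addr.
  by rewrite E bmdeg.
apply: eq_big => [f|f /eqP df].
  rewrite val_insubd degf ltnS; case: leqP => [le1|lt1]; last first.
    rewrite gtn_eqF //; apply/esym/negP => /andP [_ /eqP ef].
    move: lt1; rewrite big1 // => i _.
    have /ffunP/(_ i)/(congr1 (@nat_of_ord _)) := ef.
    by rewrite ffunE /= mnmE inordK.
  rewrite degf; case: eqP => //= df; apply/esym/eqP/ffunP=> i.
  by apply/val_inj; rewrite ffunE /= mnmE inordK.
rewrite val_insubd degf df ltnSn mpolyXE_id.
by apply: eq_bigr => i _; rewrite mnmE.
Qed.

Let alt_poly (l : 'I_N) : {poly A} :=
  \prod_(i < N | i != l) (1 - (xp i)%:P * 'X).

Let size_alt_poly l : (size (alt_poly l) <= N)%N.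
Proof.
have N0 : (0 < N)%N by case: N l => [[]|].
apply: leq_trans (size_poly_prod_leq _ _) _.
have size_lin (i : 'I_N) : (size (1 - (xp i)%:P * 'X : {poly A})%R <= 2)%N.
  apply/leq_sizeP => [[|[|j]]] // _.
  by rewrite coefB coef1 coefCM coefX mulr0 subr0.
have cardl : #|[pred i | i != l]| = N.-1.
  by rewrite cardC1 card_ord.
have : (\sum_(i < N | i != l) size (1 - (xp i)%:P * 'X : {poly A})%R <=
        \sum_(i < N | i != l) 2)%N by apply: leq_sum.
rewrite sum_nat_const cardl => le.
rewrite leq_subLR; apply: (@leq_trans (N.-1 * 2).+1); first exact: le.
by lia.
Qed.

Let geomE b x : (1 - x%:P * 'X) * geom b x = 1 - (x ^+ b.+1)%:P * 'X^(b.+1).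
Proof.
rewrite /geom (eq_bigr (fun k : 'I_b.+1 => (x%:P * 'X) ^+ k)); last first.
  by move=> k _; rewrite exprMn polyC_exp.
rewrite polyC_exp -exprMn -(opprB _ 1) -(opprB _ 1) mulNr; congr (- _).
by rewrite subrX1.
Qed.

Let alt_geom (a : nat) l :
  (alt_poly l * \prod_(i < N) geom a (xp i))`_a = xp l ^+ a.
Proof.
rewrite [X in _ * X](bigD1 l) //= mulrCA -big_split /=.
rewrite (eq_bigr _ (fun i _ => geomE a (xp i))).
have [r ->] : exists r, \prod_(i < N | i != l)
   (1 - (xp i ^+ a.+1)%:P * 'X^(a.+1)) = 1 + r * 'X^(a.+1) :> {poly A}.
  elim/big_ind: _ => [|p q [r ->] [s ->]|i _].
  - by exists 0; rewrite mul0r addr0.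
  - exists (r + s + r * s * 'X^(a.+1)).
    rewrite mulrDl mul1r mulrDr mulr1 !mulrDl -!addrA.
    by rewrite [RHS]addrC -!addrA addrC; ring.
  - by exists (- (xp i ^+ a.+1)%:P); rewrite mulNr.
rewrite mulrDr mulr1 coefD mulrA coefMXn ltnSn addr0 /geom coef_sum.
rewrite (bigD1 ord_max) //= coefCM coefXn eqxx mulr1 big1 ?addr0 // => i ni.
rewrite coefCM coefXn; case: eqP => [e|_]; last by rewrite mulr0.
by case/eqP: ni; apply/val_inj.
Qed.

Let alt_hsymz (a : nat) l :
  \sum_(k < N) (alt_poly l)`_k * hz (a%:Z - k%:Z) = xp l ^+ a.
Proof.
rewrite -alt_geom coefM.
pose g k := (alt_poly l)`_k * hz (a%:Z - k%:Z).
have hzE k : (k <= a)%N -> hz (a%:Z - k%:Z) = h (a - k).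
  by move=> le; rewrite subzn.
have -> : \sum_(i < a.+1) (alt_poly l)`_i * (\prod_i0 geom a (xp i0))`_(a - i) =
  \sum_(i < a.+1) g i.
  apply: eq_bigr => i _; rewrite hsym_coef ?leq_subr // /g hzE //.
  by rewrite -ltnS.
rewrite -/(g _) (eq_bigr (fun k : 'I_N => g k)) //.
rewrite (big_ord_widen (N + a.+1) g (leq_addr _ _)).
rewrite (big_ord_widen (N + a.+1) g (leq_addl _ _)).
rewrite big_mkcond [RHS]big_mkcond /=; apply: eq_bigr => i _ /=.
have gN : (N <= i)%N -> g i = 0.
  move=> le; rewrite /g nth_default ?mul0r //.
  exact: leq_trans (size_alt_poly l) le.
have ga : (a < i)%N -> g i = 0.
  move=> lt; rewrite /g; have -> : a%:Z - i%:Z = Negz (i - a).-1 by lia.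
  by rewrite mulr0.
by case: ltnP => [_|/gN->]; case: ltnP => // /ga.
Qed.

Let padded_det (lam : seq nat) m := \det (\matrix_(j < m, k < m)
   hz ((nth 0%N lam j)%:Z - j.+1%:Z + k.+1%:Z)).

Let hsym0 : h 0 = 1.
Proof.
rewrite -(@hsym_coef 0 0) // big1 ?coefC // => i _.
by rewrite /geom big_ord1 !expr0 mulr1.
Qed.

Let padded_detS lam m : (size lam <= m)%N ->
  padded_det lam m.+1 = padded_det lam m.
Proof.
move=> le; rewrite /padded_det (expand_det_row _ ord_max).
rewrite (bigD1 ord_max) //= big1 ?addr0 => [|k nk].
  rewrite mxE /= nth_default // /cofactor addnn -signr_odd odd_double expr0.
  have -> : 0%:Z - m.+1%:Z + m.+1%:Z = 0 by lia.
  rewrite /= hsym0 !mul1r; congr (\det _); apply/matrixP=> j k; rewrite !mxE.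
  by rewrite !lift_max.
rewrite mxE nth_default //=.
have : (k < m)%N by rewrite ltn_neqAle -ltnS ltn_ord andbT; exact: nk.
move=> lt; have -> : 0%:Z - m.+1%:Z + k.+1%:Z = Negz (m - k).-1 by lia.
by rewrite mul0r.
Qed.

Let padded_detE lam m : (size lam <= m)%N -> padded_det lam m = schur K N lam.
Proof.
move=> le; rewrite -(subnKC le); elim: (m - size lam)%N => [|d IHd].
  by rewrite addn0.
by rewrite addnS padded_detS ?leq_addr.
Qed.

Definition alternant (lam : seq nat) : A :=
  \det (\matrix_(j < N, l < N) 'X_l ^+ (nth 0%N lam j + (N - j.+1))).

(* The bialternant formula. *)
Lemma schur_bialternant (lam : seq nat) : (size lam <= N)%N ->
  schur K N lam * alternant [::] = alternant lam.
Proof.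
move=> le.
pose B := \matrix_(k < N, l < N) (alt_poly l)`_(N - k.+1).
have key (mu : seq nat) : (size mu <= N)%N -> alternant mu = schur K N mu * \det B.
  move=> lem; rewrite -(padded_detE lem) -det_mulmx; congr (\det _).
  apply/matrixP=> j l; rewrite !mxE -/(xp l) -alt_hsymz.
  rewrite (reindex_inj rev_ord_inj) /=; apply: eq_bigr => k _.
  rewrite !mxE mulrC; congr (_ * _); congr (hz _).
  by have := ltn_ord k; have := ltn_ord j; lia.
by rewrite (key lam le) (key [::]) // [schur _ _ [::]]det_mx00 mul1r.
Qed.

End Bialternant.

Section Phi.
Variables (K : fieldType) (n : nat).

(* Identities between Laurent polynomials in x_1, ..., x_n are stated in the
   field of rational functions. *)
Local Notation F := {fraction {mpoly K[n]}}.

Definition xvar (i : 'I_n) : F := tofrac ('X_i : {mpoly K[n]}).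

Definition subst (N : nat) (v : 'I_N -> F) (P : {mpoly K[N]}) : F :=
  mmap (fun c : K => tofrac (c%:MP : {mpoly K[n]})) v P.

Definition even_alphabet (i : 'I_(n + n)) : F :=
  match split i with inl j => xvar j | inr j => (xvar j)^-1 end.

Definition odd_alphabet (i : 'I_(n + n + 1)) : F :=
  match split i with inl j => even_alphabet j | inr _ => 1 end.

(* [xget 0 A] is some element of A if there is one and 0 otherwise; below, A
   has exactly one element as soon as P is symmetric. *)
Definition Phi (P : {mpoly K[n + n]}) : {mpoly K[n]} :=
  xget 0 (fun Q : {mpoly K[n]} => Q \is symmetric /\
    subst even_alphabet P = subst (fun j => xvar j + (xvar j)^-1) Q).

Definition Phi_odd (P : {mpoly K[n + n + 1]}) : {mpoly K[n]} :=
  xget 0 (fun Q : {mpoly K[n]} => Q \is symmetric /\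
    subst odd_alphabet P = subst (fun j => xvar j + (xvar j)^-1) Q).

Definition sz (lam : seq nat) := Phi (schur K (n + n) lam).
Definition spz (lam : seq nat) := Phi (schur_sp K (n + n) lam).
Definition oz (lam : seq nat) := Phi (schur_o K (n + n) lam).

Definition sz_odd (lam : seq nat) := Phi_odd (schur K (n + n + 1) lam).
Definition spz_odd (lam : seq nat) := Phi_odd (schur_sp K (n + n + 1) lam).
Definition oz_odd (lam : seq nat) := Phi_odd (schur_o K (n + n + 1) lam).

End Phi.

(* Main.v *)
Require Import Defs.
From HB Require Import structures.
From mathcomp Require Import all_boot all_order all_fingroup all_algebra.
From mathcomp Require Import complex mpoly.
From mathcomp Require Import classical_sets reals.
From mathcomp Require Import zify ring.

(** Each family is triangular with respect to degree over the Schur polynomials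
in the variables [z_i = x_i + x_i^-1], and these have pairwise distinct leading
monomials.

Since [(1 - x t) (1 - x^-1 t) = 1 - z t + t^2], the complete symmetric
polynomials of the alphabet [x_1, ..., x_n, x_1^-1, ..., x_n^-1] are the
coefficients [q_k] of the inverse of the series [\prod_i (1 - z_i t + t^2)];
for the odd alphabet there is one more factor [1 - t].  So [q_k] is a symmetric
polynomial in the [z_i], and giving [t] weight [-1] and keeping only the terms
of weight [0] turns both series into [\prod_i (1 - z_i t)]: the top-degree part
of [q_k] is [h_k] of the [z_i].

Each of the three families is a determinant in the [h_k], up to a constant, and
applying [Phi] amounts to replacing [h_k] by [q_k], because [Phi] inverts an
injective ring morphism ([subst_zvar_inj]).  In the top degree [q_k] becomes
[h_k]; the reflected terms [h_(lam_j - j - k + c)] have lower degree, except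
that they double the first column in the symplectic case, which the factor 1/2
compensates.  Hence the image is [s_lam] in the [z_i] plus terms of lower degree
([approx_det_jt]).

By the bialternant formula the leading monomial of [s_lam] is [z^lam]
([mlead_schur]).  The leading monomial of a nonzero symmetric polynomial has
nonincreasing exponents, so it is [z^lam] for exactly one partition [lam] of
length at most [n]; the family is therefore independent, and it spans by
subtraction of leading terms ([is_basis_mlead]). *)

Set Implicit Arguments.
Unset Strict Implicit.
Unset Printing Implicit Defensive.

Import Order.TTheory GRing.Theory Num.Theory.

Local Open Scope ring_scope.

(** * Inverse power series and complete symmetric polynomials *)

Section InverseSeries.
Variable A : comNzRingType.
Implicit Types p q s u : {poly A}.

(** Coefficient of [t^k] in [1/p], for [p] with constant term 1: in the geometric
    series of [1 - p] the powers beyond the [k]-th only have terms of degree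
    greater than [k].
    Being polynomial in the coefficients of [p], it is visibly compatible with
    ring morphisms, with symmetry and with degree estimates. *)
Definition inv_coef p (k : nat) : A := (\sum_(j < k.+1) (1 - p) ^+ j)`_k.

Lemma coef_exp_lt u j k : u`_0 = 0 -> (k < j)%N -> (u ^+ j)`_k = 0.
Proof.
move=> u0; elim: j k => // j IHj k ltkj.
rewrite exprS coefM big1 // => -[[|i] /= lti] _; first by rewrite u0 mul0r.
by rewrite IHj ?mulr0 //; lia.
Qed.

(** With [G] the truncated geometric series, [p * G] is 1 up to [t^a], so [s] and
    [s * p * G], which is [G] up to [t^a], have the same coefficient at [t^a]. *)
Lemma inv_coef_unique p s a : p`_0 = 1 ->
  (forall k, (k <= a)%N -> (s * p)`_k = (k == 0%N)%:R) -> s`_a = inv_coef p a.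
Proof.
move=> p0 sp; rewrite /inv_coef; set u := 1 - p; set G := \sum_(_ < _) _.
have pG : p * G = 1 - u ^+ a.+1.
  have -> : p = - (u - 1) by rewrite /u; ring.
  by rewrite mulNr -subrX1 opprB.
have ua k : (k <= a)%N -> (u ^+ a.+1)`_k = 0.
  by move=> le; rewrite coef_exp_lt // /u coefB coef1 p0 subrr.
have : (s * (p * G))`_a = s`_a.
  rewrite pG mulrBr mulr1 coefB coefMr big1 ?subr0 // => i _.
  by rewrite ua ?mulr0 // -ltnS.
move=> <-; rewrite mulrA coefM big_ord_recl sp // mul1r subn0 big1 ?addr0 //.
by move=> i _; rewrite sp ?mul0r // /bump /= ltn_ord.
Qed.

End InverseSeries.

Lemma rmorph_inv_coef (A B : comNzRingType) (f : {rmorphism A -> B})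
    (p : {poly A}) k : f (inv_coef p k) = inv_coef (map_poly f p) k.
Proof.
rewrite /inv_coef -coef_map raddf_sum /=.
have -> // : \sum_(j < k.+1) map_poly f ((1 - p) ^+ j)
  = \sum_(j < k.+1) (1 - map_poly f p) ^+ j.
by apply: eq_bigr => j _; rewrite rmorphXn rmorphB rmorph1.
Qed.

Section Complete.
Variables (K : fieldType) (N : nat).
Local Notation A := {mpoly K[N]}.

(** The complete symmetric polynomial in the variables with index in [r] only; it
    allows induction on the set of variables inside a fixed polynomial ring. *)
Definition hsym_on (r : seq 'I_N) (k : nat) : A :=
  \sum_(m : 'X_{1..N < k.+1})
     ((mdeg m == k) && [forall i, (i \in r) || (m i == 0%N)])%:R *: 'X_[m].

Lemma mcoeff_hsym_on r k m :
  (hsym_on r k)@_m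
    = ((mdeg m == k) && [forall i, (i \in r) || (m i == 0%N)])%:R.
Proof.
have [lt|le] := ltnP (mdeg m) k.+1.
  pose E (m' : 'X_{1..N}) : K :=
    ((mdeg m' == k) && [forall i, (i \in r) || (m' i == 0%N)])%:R.
  by rewrite (mcoeff_mpoly E lt).
rewrite gtn_eqF //= raddf_sum /= big1 // => b _.
rewrite mcoeffZ mcoeffX; case: (val b =P m) => [E|_]; last by rewrite mulr0.
by have := bmdeg b; rewrite E; lia.
Qed.

Lemma hsym_on_nil k : hsym_on [::] k = (k == 0%N)%:R.
Proof.
apply/mpolyP=> m; rewrite mcoeff_hsym_on -mpolyC_nat mcoeffC.
rewrite -natrM mulnb; congr (nat_of_bool _)%:R.
apply/andP/andP => [[/eqP <- /forallP m0]|[/eqP -> /eqP Em]].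
  have -> : m = 0%MM by apply/mnmP=> i; rewrite mnm0E; apply/eqP/m0.
  by rewrite mdeg0.
by rewrite ?{}Em ?mdeg0; split=> //; apply/forallP=> i; rewrite mnm0E.
Qed.

(** A monomial in the variables [i :: r] either avoids [i] or is [X_i] times
    another such monomial. *)
Lemma hsym_on_cons i r k : i \notin r ->
  hsym_on (i :: r) k.+1 - 'X_i * hsym_on (i :: r) k = hsym_on r k.+1.
Proof.
move=> ir; apply/eqP; rewrite subr_eq addrC; apply/eqP/mpolyP=> m.
rewrite mcoeffD mcoeff_hsym_on [X in _ + X]mcoeff_hsym_on mulrC.
have [mi0|mi] := posnP (m i).
  rewrite memN_msupp_eq0 ?add0r; last first.
    rewrite (perm_mem (msuppMX _ _)); apply/mapP=> -[m' _ E].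
    by move: mi0; rewrite E mnmDE mnm1E eqxx.
  congr (nat_of_bool (_ && _))%:R; apply: eq_forallb => j; rewrite inE.
  by case: eqP => [->|]; rewrite ?mi0 ?orbT.
have -> : m = (U_(i) + (m - U_(i)))%MM.
  rewrite addmC submK //; apply/mnm_lepP=> j; rewrite mnm1E.
  by case: eqP => [<-|].
set m' := (m - U_(i))%MM; rewrite mcoeffMX mcoeff_hsym_on mdegD mdeg1 add1n eqSS.
rewrite -natrD; congr (_%:R).
have -> : [forall j, (j \in r) || ((U_(i) + m')%MM j == 0%N)] = false.
  by apply/negbTE/forallPn; exists i; rewrite negb_or ir mnmDE mnm1E eqxx.
rewrite andbF addn0; congr (nat_of_bool (_ && _)); apply: eq_forallb => j.
by rewrite inE mnmDE mnm1E eq_sym; case: eqP.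
Qed.

(** Multiplication by [1 - X_i t] removes the variable [i] from the generating
    series, so the whole product leaves the generating series of no variable. *)
Lemma hsym_on_series r a k : uniq r -> (k <= a)%N ->
  ((\poly_(j < a.+1) hsym_on r j) * \prod_(i <- r) (1 - ('X_i)%:P * 'X))`_k
    = (k == 0%N)%:R :> A.
Proof.
elim: r k => [|i r IHr] k /=.
  by rewrite big_nil mulr1 coef_poly ltnS => _ ->; rewrite hsym_on_nil.
case/andP=> ir ur le; rewrite big_cons mulrA -IHr // !coefM.
apply: eq_bigr => -[j /= ltj] _; congr (_ * _).
have lej : (j <= a)%N by lia.
rewrite mulrBr mulr1 mulrCA coefB coefCM coefMX !coef_poly !ltnS lej.
case: j lej {ltj} => [|j] lej /=.
  rewrite mulr0 subr0; apply/mpolyP=> m; rewrite !mcoeff_hsym_on.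
  case: eqP => //= /eqP; rewrite mdeg_eq0 => /eqP ->.
  by congr (nat_of_bool _)%:R; apply: eq_forallb => l; rewrite mnm0E eqxx !orbT.
by rewrite ltnW // hsym_on_cons.
Qed.

Lemma hsym_series k :
  hsym K N k = inv_coef (\prod_(i < N) (1 - ('X_i)%:P * 'X)) k.
Proof.
have hE : hsym K N k = hsym_on (index_enum 'I_N) k.
  rewrite /hsym /hsym_on big_mkcond; apply: eq_bigr => m _.
  have -> : [forall i, (i \in index_enum 'I_N) || (m i == 0%N)].
    by apply/forallP=> i; rewrite mem_index_enum.
  by rewrite andbT; case: eqP; rewrite ?scale1r ?scale0r.
rewrite -(@inv_coef_unique _ _ (\poly_(j < k.+1) hsym_on (index_enum 'I_N) j)).
- by rewrite coef_poly ltnSn.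
- rewrite -horner_coef0 horner_prod big1 // => i _.
  by rewrite horner_coef0 coefB coef1 coefMX subr0.
by move=> j le; rewrite hsym_on_series ?index_enum_uniq.
Qed.

End Complete.

(** * Approximation by terms of top degree *)

Section Leading.
Variables (K : fieldType) (n : nat).
Local Notation A := {mpoly K[n]}.
Implicit Types (d e : int) (p q : A).

(** The bound is an integer, possibly negative, so that entries of Jacobi-Trudi
    matrices with a negative index, which vanish, need no special treatment. *)
Definition deg_le d p : Prop := forall m, m \in msupp p -> (mdeg m)%:Z <= d.

(** [p] equals [q] up to terms of degree less than [d], both being of degree at
    most [d]: they have the same component of degree [d]. *)
Definition approx d p q : Prop := deg_le d q /\ deg_le (d - 1) (p - q).

Lemma deg_le0 d : deg_le d 0.
Proof. by move=> m; rewrite msupp0. Qed.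

Lemma deg_le_trans d e p : d <= e -> deg_le d p -> deg_le e p.
Proof. by move=> le pd m /pd /le_trans; apply. Qed.

Lemma deg_leD d p q : deg_le d p -> deg_le d q -> deg_le d (p + q).
Proof.
by move=> pd qd m /msuppD_le; rewrite mem_cat => /orP[/pd|/qd].
Qed.

Lemma deg_leN d p : deg_le d p -> deg_le d (- p).
Proof. by move=> pd m; rewrite (perm_mem (msuppN p)) => /pd. Qed.

Lemma deg_leM d e p q : deg_le d p -> deg_le e q -> deg_le (d + e) (p * q).
Proof.
move=> pd qe m /msuppM_le /allpairsP [[m1 m2] /= [/pd le1 /qe le2 ->]].
by rewrite mdegD PoszD lerD.
Qed.

Lemma deg_leX d m : (mdeg m)%:Z <= d -> deg_le d 'X_[m].
Proof. by move=> le m'; rewrite msuppX inE => /eqP ->. Qed.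

Lemma approx_deg_le d p q : approx d p q -> deg_le d p.
Proof.
case=> qd pq; rewrite -(subrK q p); apply: deg_leD => //.
by apply: deg_le_trans pq; rewrite gerBl.
Qed.

Lemma approx_refl d p : deg_le d p -> approx d p p.
Proof. by move=> pd; split=> //; rewrite subrr; apply: deg_le0. Qed.

Lemma approx1 : approx 0 1 1.
Proof.
by apply: approx_refl; rewrite -mpolyX0; apply: deg_leX; rewrite mdeg0.
Qed.

Lemma approxD d p q p' q' :
  approx d p q -> approx d p' q' -> approx d (p + p') (q + q').
Proof.
move=> [qd pq] [qd' pq']; split; first exact: deg_leD.
by rewrite opprD addrACA; apply: deg_leD.
Qed.

Lemma approxN d p q : approx d p q -> approx d (- p) (- q).
Proof. by case=> qd pq; split; rewrite -?opprD; apply: deg_leN. Qed.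

(** The error of a product is the sum of two products that each have one
   error as a factor. *)
Lemma approxM d e p q p' q' :
  approx d p q -> approx e p' q' -> approx (d + e) (p * p') (q * q').
Proof.
move=> pq pq'; have p'e := approx_deg_le pq'.
case: pq pq' => [qd pq] [q'e pq']; split; first exact: deg_leM.
have -> : p * p' - q * q' = (p - q) * p' + q * (p' - q') by ring.
apply: deg_leD; first by rewrite addrAC; apply: deg_leM.
by rewrite -addrA; apply: deg_leM.
Qed.

Lemma approx_sum d (I : Type) (r : seq I) (P : pred I) (F G : I -> A) :
  (forall i, P i -> approx d (F i) (G i)) ->
  approx d (\sum_(i <- r | P i) F i) (\sum_(i <- r | P i) G i).
Proof.
move=> FG; elim/big_rec2: _ => [|i p q Pi pq].
  exact/approx_refl/deg_le0.
by apply: approxD => //; apply: FG.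
Qed.

Lemma approx_prod (I : Type) (r : seq I) (d : I -> int) (F G : I -> A) :
  (forall i, approx (d i) (F i) (G i)) ->
  approx (\sum_(i <- r) d i) (\prod_(i <- r) F i) (\prod_(i <- r) G i).
Proof.
move=> FG; elim: r => [|i r IHr]; first by rewrite !big_nil; apply: approx1.
by rewrite !big_cons; apply: approxM.
Qed.

(** When the degree of the [(i, j)] entry has the form [a i + b j], all terms of
    the Leibniz expansion have the same degree, so that the estimate of each
    product carries over to the sum. *)
Lemma approx_det m (a b : 'I_m -> int) (B C : 'M[A]_m) :
  (forall i j, approx (a i + b j) (B i j) (C i j)) ->
  approx (\sum_i (a i + b i)) (\det B) (\det C).
Proof.
move=> BC; rewrite /determinant; apply: approx_sum => s _.
have -> : \sum_i (a i + b i) = \sum_i (a i + b (s i)).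
  rewrite !big_split /=; congr (_ + _).
  by rewrite [LHS](reindex_inj (@perm_inj _ s)).
have := approx_prod (index_enum 'I_m) (fun i => BC i (s i)).
by rewrite !mulr_sign; case: (s : bool) => //; apply: approxN.
Qed.

(** The variable of the power series has weight [-1], whence the weight [i] of
    the coefficient of index [i]. *)
Definition approx_poly (p q : {poly A}) : Prop :=
  forall i, approx i%:Z p`_i q`_i.

Lemma approx_poly1 : approx_poly 1 1.
Proof.
move=> i; rewrite coef1; case: i => [|i] /=; first exact: approx1.
exact/approx_refl/deg_le0.
Qed.

Lemma approx_polyB (p q p' q' : {poly A}) :
  approx_poly p q -> approx_poly p' q' -> approx_poly (p - p') (q - q').
Proof.
by move=> pq pq' i; rewrite !coefB; apply: approxD => //; apply: approxN.
Qed.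

Lemma approx_polyM (p q p' q' : {poly A}) :
  approx_poly p q -> approx_poly p' q' -> approx_poly (p * p') (q * q').
Proof.
move=> pq pq' i; rewrite !coefM; apply: approx_sum => j _.
have -> : i%:Z = j%:Z + (i - j)%N%:Z by have := ltn_ord j; lia.
exact: approxM.
Qed.

Lemma approx_poly_prod (I : Type) (r : seq I) (F G : I -> {poly A}) :
  (forall i, approx_poly (F i) (G i)) ->
  approx_poly (\prod_(i <- r) F i) (\prod_(i <- r) G i).
Proof.
move=> FG; elim: r => [|i r IHr]; first by rewrite !big_nil; apply: approx_poly1.
by rewrite !big_cons; apply: approx_polyM.
Qed.

Lemma approx_inv_coef (p q : {poly A}) k :
  approx_poly p q -> approx k%:Z (inv_coef p k) (inv_coef q k).
Proof.
move=> pq; rewrite /inv_coef !coef_sum; apply: approx_sum => j _.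
have := approx_poly_prod (index_enum 'I_j)
          (fun _ => approx_polyB approx_poly1 pq).
by rewrite !prodr_const card_ord; apply.
Qed.

Lemma mlead_eq p (m : 'X_{1..n}) :
  p@_m != 0 -> (forall m', p@_m' != 0 -> (m' <= m)%O) -> mlead p = m.
Proof.
move=> pm max_m; apply/eqP; rewrite eq_le msupp_le_mlead ?mcoeff_msupp // andbT.
apply: max_m; rewrite mleadc_eq0; apply: contraNneq pm => ->.
by rewrite mcoeff0.
Qed.

(** Monomials are compared by degree first, so terms of lower degree do not
    affect the leading one. *)
Lemma approx_mlead p q : q != 0 -> approx (mdeg (mlead q))%:Z p q ->
  mlead p = mlead q /\ p != 0.
Proof.
move=> q0 [_ pq]; have low m : (mdeg (mlead q) <= mdeg m)%N -> p@_m = q@_m.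
  move=> le; apply/eqP; rewrite -subr_eq0 -mcoeffB mcoeff_eq0.
  by apply/negP => /pq; lia.
have plead : p@_(mlead q) != 0 by rewrite low // mleadc_eq0.
split; last by apply: contraNneq plead => ->; rewrite mcoeff0.
apply: mlead_eq => // m; have [le|lt _] := leqP (mdeg (mlead q)) (mdeg m).
  by rewrite low // -mcoeff_msupp; apply: msupp_le_mlead.
by apply/ltW/lt_mdeg_ltmc.
Qed.

End Leading.

(** * Leading monomials of Schur polynomials *)

Lemma geq_trans : transitive geq.
Proof. by move=> x y z yx xz; apply: leq_trans xz yx. Qed.

Section SchurLead.
Variables (K : fieldType) (n : nat).
Local Notation A := {mpoly K[n]}.

Definition part_mnm (lam : seq nat) : 'X_{1..n} :=
  [multinom nth 0%N lam i | i < n].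

Definition staircase : 'X_{1..n} := [multinom (n - i.+1)%N | i < n].

Lemma part_nonincr lam i j : sorted geq lam -> (i <= j)%N ->
  (nth 0%N lam j <= nth 0%N lam i)%N.
Proof.
move=> slam leij; have [lt|le] := ltnP j (size lam); last first.
  by rewrite (nth_default _ le).
apply: (sorted_leq_nth geq_trans _ 0%N slam) => //; first by move=> x /=.
by rewrite inE (leq_ltn_trans leij).
Qed.

(** The exponents of [part_mnm lam + staircase] decrease strictly, so at the first
    index moved by a permutation the permuted exponent is smaller: the identity
    term of the Leibniz expansion leads, with coefficient 1. *)
Lemma mlead_alternant lam : sorted geq lam ->
  mlead (alternant K n lam) = (part_mnm lam + staircase)%MM
  /\ alternant K n lam != 0.
Proof.
move=> slam; set mu := (part_mnm lam + staircase)%MM.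
have mu_decr (i j : 'I_n) : (i < j)%N -> (mu j < mu i)%N.
  move=> lt; rewrite !mnmE.
  have := part_nonincr slam (ltnW lt); have := ltn_ord j; lia.
pose ms (s : 'S_n) : 'X_{1..n} := [multinom mu (s i) | i < n].
have ms_lt s : s != 1%g -> (ms s < mu)%O.
  move=> s1; have [i si] : exists i, s i != i.
    apply/existsP; apply: contraNT s1; rewrite negb_exists => /forallP s1.
    by apply/eqP/permP=> i; rewrite perm1; apply/eqP/negbNE/s1.
  have [i0 si0 min_i0] := @arg_minnP _ i (fun j => s j != j) val si.
  have fixs (j : 'I_n) : (j < i0)%N -> s j = j.
    by move=> lt; apply/eqP; apply: contraTT lt => /min_i0; rewrite leqNgt.
  apply/ltmcP; first by rewrite mdeg_mperm.
  exists i0 => [j /fixs sj|]; first by rewrite mnmE sj.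
  rewrite mnmE; apply: mu_decr; rewrite ltn_neqAle eq_sym si0 /= leqNgt.
  by apply: contra si0 => lt; rewrite -(inj_eq (@perm_inj _ s)) fixs.
have altE : alternant K n lam = \sum_(s : 'S_n) (-1) ^+ s *: 'X_[ms s].
  rewrite /alternant -det_tr /determinant; apply: eq_bigr => s _.
  rewrite scaler_sign mulr_sign (mpolyXE_id K (ms s)).
  have -> // : \prod_i (\matrix_(j, l)
                  'X_l ^+ (nth 0%N lam j + (n - j.+1)))^T i (s i)
     = \prod_(i < n) ('X_i : A) ^+ ms s i.
  by apply: eq_bigr => i _; rewrite !mxE !mnmE.
have coefE m : (alternant K n lam)@_m
    = \sum_(s : 'S_n) (-1) ^+ s * (ms s == m)%:R.
  by rewrite altE raddf_sum; apply: eq_bigr => s _; rewrite /= mcoeffZ mcoeffX.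
have ms1 : ms 1%g = mu by apply/mnmP=> i; rewrite mnmE perm1.
have lead1 : (alternant K n lam)@_mu != 0.
  rewrite coefE (bigD1 1%g) //= ms1 eqxx odd_perm1 expr0 mulr1.
  rewrite big1 ?addr0 ?oner_neq0 // => s /ms_lt; rewrite lt_def.
  by case/andP=> ne _; rewrite eq_sym (negbTE ne) mulr0.
split; last by apply: contraNneq lead1 => ->; rewrite mcoeff0.
apply: mlead_eq => // m; rewrite coefE => nz.
suff [s <-] : exists s, ms s = m.
  by have [->|/ms_lt/ltW//] := eqVneq s 1%g; rewrite ms1.
apply/exists_eqP; apply: contraNT nz; rewrite negb_exists => /forallP ne.
by rewrite big1 // => s _; rewrite (negbTE (ne s)) mulr0.
Qed.

(** Leading monomials are additive, so those of the two alternants in the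
    bialternant formula subtract. *)
Lemma mlead_schur lam : sorted geq lam -> (size lam <= n)%N ->
  mlead (schur K n lam) = part_mnm lam /\ schur K n lam != 0.
Proof.
move=> slam le; have /esym E := schur_bialternant K le.
have [lead_lam lam0] := mlead_alternant slam.
have [lead_nil nil0] := mlead_alternant (isT : sorted geq [::]).
have s0 : schur K n lam != 0.
  by apply: contraNneq lam0; rewrite E => ->; rewrite mul0r.
split=> //; have := congr1 (@mlead _ _) E; rewrite mleadM // lead_lam lead_nil.
have -> : part_mnm [::] = 0%MM by apply/mnmP=> i; rewrite !mnmE nth_nil.
by rewrite add0m => /addIm.
Qed.

Lemma mdeg_part lam : (size lam <= n)%N ->
  mdeg (part_mnm lam) = (\sum_(i < size lam) nth 0%N lam i)%N.
Proof.
move=> le; rewrite mdegE (eq_bigr (fun i : 'I_n => nth 0%N lam i)).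
  rewrite (big_ord_widen n _ le) [RHS]big_mkcond; apply: eq_bigr => i _.
  by case: ltnP => // ?; rewrite nth_default.
by move=> i _; rewrite mnmE.
Qed.

End SchurLead.

(** * Bases of symmetric polynomials from leading monomials *)

Section PartBasis.
Variables (K : fieldType) (n : nat).
Local Notation A := {mpoly K[n]}.

(** The positive entries of a nonincreasing sequence form a prefix, and 0 is the
    default value of [nth]. *)
Lemma nth_filter_pos (s : seq nat) i : sorted geq s ->
  nth 0%N [seq x <- s | (0 < x)%N] i = nth 0%N s i.
Proof.
elim: s i => //= x s IHs i.
rewrite (path_sortedE geq_trans) => /andP[/allP xs ss].
have [x0|x_gt0] := posnP x; last by case: i => //= i; apply: IHs.
have s0 y : y \in s -> y = 0%N by move/xs; rewrite /geq x0 /= leqn0 => /eqP.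
rewrite (eq_in_filter (a2 := pred0)) => [|y /s0 ->] //.
rewrite filter_pred0 nth_nil x0; case: i => //= i.
have [lt|le] := ltnP i (size s); last by rewrite nth_default.
by rewrite (s0 _ (mem_nth _ lt)).
Qed.

(** Partitions are stored without zeros, so their padded exponent vector
    determines the length. *)
Lemma size_le_part_mnm (s t : seq nat) : 0%N \notin t -> (size t <= n)%N ->
  part_mnm n s = part_mnm n t -> (size t <= size s)%N.
Proof.
move=> t0 tn /mnmP st; rewrite leqNgt; apply: contra t0 => lt.
have := st (Ordinal (leq_trans lt tn)).
by rewrite !mnmE /= nth_default // => ->; apply: mem_nth.
Qed.

Lemma part_mnm_inj : injective (fun lam : Par n => part_mnm n lam).
Proof.
move=> [l pl] [l' pl'] /= E; apply/val_inj => /=.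
case/andP: (pl) => /andP[_ l0] ln; case/andP: (pl') => /andP[_ l0'] ln'.
have sizeE : size l = size l'.
  by apply/eqP; rewrite eqn_leq !size_le_part_mnm.
apply: (@eq_from_nth _ 0%N) => // i lti.
by have /mnmP/(_ (Ordinal (leq_trans lti ln))) := E; rewrite !mnmE.
Qed.

Lemma part_mnm_surj (m : 'X_{1..n}) :
  (forall i j : 'I_n, (i <= j)%N -> (m j <= m i)%N) ->
  exists lam : Par n, part_mnm n lam = m.
Proof.
move=> m_decr; pose s := [seq m i | i <- enum 'I_n].
have nths (i : 'I_n) : nth 0%N s i = m i.
  by rewrite (nth_map i) ?size_enum_ord // nth_ord_enum.
have size_s : size s = n by rewrite size_map size_enum_ord.
have s_sorted : sorted geq s.
  apply/(sortedP 0%N) => i; rewrite size_s => lt.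
  by rewrite (nths (Ordinal lt)) (nths (Ordinal (ltnW lt))) /= m_decr /=.
have lamP : is_partition [seq x <- s | (0 < x)%N]
    && (size [seq x <- s | (0 < x)%N] <= n)%N.
  rewrite /is_partition (sorted_filter geq_trans) // mem_filter /=.
  by rewrite -size_s size_filter count_size.
exists (MkPar lamP); apply/mnmP=> i.
by rewrite mnmE /= nth_filter_pos // nths.
Qed.

Lemma exists_max (T : eqType) (f : T -> 'X_{1..n}) (s : seq T) :
  s != [::] -> exists2 i, i \in s & {in s, forall j, (f j <= f i)%O}.
Proof.
elim: s => // x s IHs _; have [->|/IHs [i si max_i]] := eqVneq s [::].
  by exists x => [|j]; rewrite ?mem_seq1 // => /eqP ->.
have [le|/ltW le] := leP (f x) (f i).
  exists i => [|j]; first by rewrite inE si orbT.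
  by rewrite inE => /predU1P[->|/max_i].
exists x => [|j]; first exact: mem_head.
by rewrite inE => /predU1P[->//|/max_i /le_trans]; apply.
Qed.

(** Independence: the largest leading monomial among the terms with nonzero
    coefficient cannot cancel.  Spanning: subtracting the multiple of [v lam] with
    the leading term of a symmetric polynomial lowers its leading monomial, and
    the order on monomials is well founded. *)
Lemma is_basis_mlead (v : Par n -> A) :
  (forall lam, v lam \is symmetric) -> (forall lam, v lam != 0) ->
  (forall lam, mlead (v lam) = part_mnm n lam) ->
  is_basis (@symmetric n K) v.
Proof.
move=> v_sym v0 v_lead; split=> //.
- move=> s c us sum0 i si; apply/eqP/negPn/negP => ci.
  have : [seq j <- s | c j != 0] != [::].
    by rewrite -has_filter; apply/hasP; exists i.
  case/(exists_max (fun j : Par n => part_mnm n j)) => k.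
  rewrite mem_filter => /andP[ck sk] max_k.
  have := congr1 (mcoeff (part_mnm n k)) sum0.
  rewrite raddf_sum (bigD1_seq k) //= mcoeffZ mcoeff0 big_seq_cond big1 => [|j].
    move=> /eqP; rewrite addr0 mulf_eq0 (negbTE ck) -v_lead mleadc_eq0.
    by rewrite (negbTE (v0 k)).
  case/andP=> sj jk; rewrite mcoeffZ.
  have [->|cj] := eqVneq (c j) 0; first by rewrite mul0r.
  rewrite mcoeff_gt_mlead ?mulr0 // v_lead lt_neqAle.
  by rewrite (inj_eq part_mnm_inj) jk max_k // mem_filter cj.
(* The bound on the leading monomials keeps the list of indices duplicate-free
   when the induction adds a new index. *)
suff span x : x \is symmetric -> exists (s : seq (Par n)) (c : Par n -> K),
    [/\ uniq s, x = \sum_(i <- s) c i *: v i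
      & {in s, forall i : Par n, (part_mnm n i <= mlead x)%O}].
  by move=> x /span [s [c [us xE _]]]; exists s, c.
elim/mleadrect: x => x IHx x_sym; have [->|x0] := eqVneq x 0.
  by exists [::], (fun=> 0); rewrite big_nil.
have [lam lamE] := part_mnm_surj (mlead_msym_sorted x_sym).
pose a := mleadc x / mleadc (v lam); pose y := x - a *: v lam.
have y_lam : y@_(part_mnm n lam) = 0.
  rewrite mcoeffB mcoeffZ {1}lamE -v_lead /a divfK ?subrr //.
  by rewrite mleadc_eq0.
have y_sym : y \is symmetric by rewrite rpredB ?rpredZ.
have [y0|y0] := eqVneq y 0.
  exists [:: lam], (fun=> a); split=> //.
    by rewrite big_seq1; apply/eqP; rewrite -subr_eq0 -/y y0.
  by move=> j; rewrite mem_seq1 => /eqP ->; rewrite lamE.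
have lty : (mlead y < mlead x)%O.
  rewrite lt_neqAle; apply/andP; split.
    by apply: contra_neq y0 => E; apply/eqP; rewrite -mleadc_eq0 E -lamE y_lam.
  apply: le_trans (mleadB_le _ _) _; rewrite leUx lexx /=.
  by apply: le_trans (mleadZ_le _ _) _; rewrite v_lead lamE.
have [s [c [us yE s_le]]] := IHx y lty y_sym.
have lam_s : lam \notin s.
  by apply/negP => /s_le; rewrite lamE leNgt lty.
exists (lam :: s), (fun i => if i == lam then a else c i); split.
- by rewrite /= lam_s.
- rewrite big_cons eqxx; apply/eqP; rewrite addrC -subr_eq -/y yE.
  apply/eqP/eq_big_seq => i si; case: eqP => // E.
  by rewrite E (negbTE lam_s) in si.
move=> i; rewrite inE => /predU1P[->|/s_le le]; first by rewrite lamE.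
exact/ltW/(le_lt_trans le).
Qed.

End PartBasis.

(** * The substitution of x + 1/x *)

Section Substitution.
Variables (K : fieldType) (n : nat).
Local Notation A := {mpoly K[n]}.
Local Notation F := {fraction {mpoly K[n]}}.

HB.instance Definition _ (N : nat) (v : 'I_N -> F) :=
  GRing.RMorphism.copy (subst v) (mmap (@tofrac _ \o @mpolyC n K) v).

Lemma subst_var N (v : 'I_N -> F) i : subst v 'X_i = v i.
Proof.
have := mmapX v (@tofrac _ \o @mpolyC n K) U_(i).
by rewrite mmap1U.
Qed.

Lemma substZ N (v : 'I_N -> F) c P :
  subst v (c *: P) = tofrac (c%:MP : A) * subst v P.
Proof. exact: (mmapZ v (@tofrac _ \o @mpolyC n K)). Qed.

Definition zvar (i : 'I_n) : F := xvar K i + (xvar K i)^-1.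

Lemma xvar_neq0 (i : 'I_n) : xvar K i != 0.
Proof. by rewrite tofrac_eq0 -msupp_eq0 msuppX. Qed.

(** The monomial [z^m], of degree at most [d], after multiplication by
    [(x_1 ... x_n)^d] to make it a polynomial in [x]. *)
Definition clear_denom (d : nat) (m : 'X_{1..n}) : A :=
  \prod_(i < n) ('X_i ^+ (d - m i) * ('X_i ^+ 2 + 1) ^+ m i).

Lemma clear_denomE d m : (mdeg m <= d)%N ->
  tofrac (clear_denom d m) = \prod_(i < n) xvar K i ^+ d * mmap1 zvar m.
Proof.
move=> le; rewrite /clear_denom /mmap1 rmorph_prod /= -big_split /=.
apply: eq_bigr => i _; have mi : (m i <= d)%N.
  by apply: leq_trans le; rewrite mdegE (bigD1 i) //= leq_addr.
rewrite rmorphM !rmorphXn rmorphD rmorphXn rmorph1 -/(xvar K i).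
have -> : xvar K i ^+ 2 + 1 = xvar K i * zvar i.
  by rewrite /zvar mulrDr divff ?xvar_neq0.
by rewrite exprMn mulrA -exprD subnK.
Qed.

Lemma mlead_clear_denom d m : (mdeg m <= d)%N ->
  mlead (clear_denom d m) = ([multinom d | _ < n] + m)%MM
  /\ clear_denom d m != 0.
Proof.
move=> le.
have X0 (i : 'I_n) : ('X_i : A) != 0 by rewrite -msupp_eq0 msuppX.
have lead_lin (i : 'I_n) : mlead ('X_i ^+ 2 + 1 : A) = (U_(i) *+ 2)%MM.
  rewrite mleadDl mleadX // mleadXm // mlead1.
  by apply: lt_mdeg_ltmc; rewrite mdeg0 mdegMn mdeg1.
have lin0 (i : 'I_n) : ('X_i ^+ 2 + 1 : A) != 0.
  apply/eqP=> E; have := lead_lin i; rewrite E mlead0 => /(congr1 mdeg).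
  by rewrite mdeg0 mdegMn mdeg1.
have fact0 (i : 'I_n) : 'X_i ^+ (d - m i) * ('X_i ^+ 2 + 1) ^+ m i != 0 :> A.
  by rewrite mulf_neq0 // expf_neq0.
split; last by apply/prodf_neq0.
rewrite /clear_denom mlead_prod //; apply/mnmP=> j.
rewrite mnm_sumE (bigD1 j) //= big1 ?addn0 => [|i ij]; last first.
  rewrite mleadM ?expf_neq0 // !mleadX // mleadXm lead_lin.
  by rewrite !(mnmDE, mulmnE, mnm1E) (negbTE ij).
rewrite mleadM ?expf_neq0 // !mleadX // mleadXm lead_lin.
rewrite !(mnmDE, mulmnE, mnm1E, mnmE) eqxx.
have : (m j <= d)%N.
  by apply: leq_trans le; rewrite mdegE (bigD1 j) //= leq_addr.
lia.
Qed.

(** After clearing denominators, the images of distinct monomials [z^m] have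
    distinct leading monomials [x^(d + m)], in the same order as the [m]; the
    image of the leading term of [Q] does not cancel. *)
Lemma subst_zvar_inj : injective (subst zvar).
Proof.
apply: raddf_inj => Q Q0; apply/eqP/negPn/negP => nzQ.
set d := msize Q.
have led m : m \in msupp Q -> (mdeg m <= d)%N by move/msize_mdeg_lt/ltnW.
have sum0 : \sum_(m <- msupp Q) Q@_m *: clear_denom d m = 0.
  apply/eqP; rewrite -tofrac_eq0 rmorph_sum /=.
  have -> : \sum_(m <- msupp Q) tofrac (Q@_m *: clear_denom d m)
     = \prod_(i < n) xvar K i ^+ d * subst zvar Q.
    rewrite /subst /mmap mulr_sumr; apply: eq_big_seq => m /led le.
    by rewrite -mul_mpolyC rmorphM /= clear_denomE // mulrCA.
  by rewrite Q0 mulr0.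
have supp_lead := mlead_supp nzQ.
have [lead_m nz_m] := mlead_clear_denom (led _ supp_lead).
have := congr1 (mcoeff (mlead (clear_denom d (mlead Q)))) sum0.
rewrite raddf_sum (bigD1_seq (mlead Q)) //= mcoeffZ mcoeff0 big_seq_cond big1.
  by move/eqP; rewrite addr0 mulf_eq0 !mleadc_eq0 (negbTE nzQ) (negbTE nz_m).
move=> m /andP[sm ne].
rewrite mcoeffZ [X in _ * X]mcoeff_gt_mlead ?mulr0 // lead_m.
have [-> _] := mlead_clear_denom (led _ sm).
by rewrite ltmc_add2r lt_neqAle ne msupp_le_mlead.
Qed.

(** The common form of [Phi] and [Phi_odd], for an arbitrary alphabet [v]. *)
Definition descent N (v : 'I_N -> F) (P : {mpoly K[N]}) : A :=
  xget 0 (fun Q : A => Q \is symmetric /\ subst v P = subst zvar Q).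

Lemma descent_unique N (v : 'I_N -> F) P Q :
  Q \is symmetric -> subst v P = subst zvar Q -> descent v P = Q.
Proof.
move=> Q_sym PQ; apply: xget_unique => // Q' [_ PQ'].
by apply: subst_zvar_inj; rewrite -PQ.
Qed.

End Substitution.

(** * Jacobi-Trudi determinants and their top-degree parts *)

Section JacobiTrudi.

Definition ext0 (A : zmodType) (q : nat -> A) (k : int) : A :=
  if k is Posz j then q j else 0.

(** One matrix for the three families, over any sequence [q] in place of the
    complete symmetric polynomials: the coefficient [s] and the shift [c] of
    the reflected term are 0, 0 for [schur], -1, 0 for [schur_o] and 1, 2 for
    [schur_sp]. *)
Definition jt_mx (A : zmodType) (s c : int) (q : nat -> A) (lam : seq nat) :
    'M[A]_(size lam) :=
  \matrix_(j, k)
    (ext0 q ((nth 0%N lam j)%:Z - j.+1%:Z + k.+1%:Z)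
     + ext0 q ((nth 0%N lam j)%:Z - j.+1%:Z - k.+1%:Z + c) *~ s).

Lemma schur_jt (K : fieldType) N lam :
  schur K N lam = \det (jt_mx 0 0 (hsym K N) lam).
Proof. by congr (\det _); apply/matrixP=> j k; rewrite !mxE mulr0z addr0. Qed.

Lemma schur_o_jt (K : fieldType) N lam :
  schur_o K N lam = \det (jt_mx (-1) 0 (hsym K N) lam).
Proof. by congr (\det _); apply/matrixP=> j k; rewrite !mxE mulrN1z addr0. Qed.

Lemma schur_sp_jt (K : fieldType) N lam :
  schur_sp K N lam = (if lam is [::] then 1 else 2%:R^-1)
                       *: \det (jt_mx 1 2 (hsym K N) lam).
Proof.
case: lam => [|l lam]; first by rewrite det_mx00 scale1r.
by congr (_ *: \det _); apply/matrixP=> j k; rewrite !mxE mulr1z.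
Qed.

Lemma rmorph_det_jt (A B : comNzRingType) (f : {rmorphism A -> B}) s c
    (q : nat -> A) (q' : nat -> B) lam :
  (forall k, f (q k) = q' k) ->
  f (\det (jt_mx s c q lam)) = \det (jt_mx s c q' lam).
Proof.
move=> fq; rewrite -det_map_mx; congr (\det _); apply/matrixP=> j k.
have fext0 i : f (ext0 q i) = ext0 q' i by case: i => i //=; rewrite rmorph0.
by rewrite !mxE rmorphD rmorphMz !fext0.
Qed.

Variables (K : fieldType) (n : nat).
Local Notation A := {mpoly K[n]}.

Lemma det_jt_sym s c (q : nat -> A) lam : (forall k, q k \is symmetric) ->
  \det (jt_mx s c q lam) \is symmetric.
Proof.
move=> q_sym; have ext0_sym k : ext0 q k \is symmetric.
  by case: k => k //=; rewrite rpred0.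
rewrite /determinant rpred_sum // => u _.
rewrite mulr_sign; case: (u : bool); rewrite ?rpredN rpred_prod // => i _;
by rewrite mxE rpredD // rpredMz.
Qed.

(** The reflected term has the degree of the main term exactly in the columns [k]
    with [2 (k + 1) = c], where it multiplies the top-degree part by [1 + s]. *)
Definition jt_weight (s c : int) (lam : seq nat) : K :=
  \prod_(k < size lam) (1 + (if c == (2 * k.+1)%N%:Z then s%:~R else 0)).

Lemma approx_ext0 (q h : nat -> A) (k : int) :
  (forall i, approx i%:Z (q i) (h i)) -> approx k (ext0 q k) (ext0 h k).
Proof. by case: k => k qh //=; apply/approx_refl/deg_le0. Qed.

Lemma deg_leZ d a (p : A) : deg_le d p -> deg_le d (a *: p).
Proof. by move=> pd m /msuppZ_le /pd. Qed.

Lemma approxZ d a (p q : A) : approx d p q -> approx d (a *: p) (a *: q).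
Proof. by case=> qd pq; split; rewrite -?scalerBr; apply: deg_leZ. Qed.

(** Entrywise, [q] may be replaced by the complete symmetric polynomials, and the
    reflected term either repeats the main one or has lower degree; the factors
    of the columns then come out of the determinant. *)
Lemma approx_det_jt s c (q : nat -> A) lam : c <= 2 -> (size lam <= n)%N ->
  (forall k, approx k%:Z (q k) (hsym K n k)) ->
  approx (mdeg (part_mnm n lam))%:Z
    (\det (jt_mx s c q lam)) (jt_weight s c lam *: schur K n lam).
Proof.
move=> c2 le qh; pose h := hsym K n.
pose w (k : 'I_(size lam)) : K :=
  1 + (if c == (2 * k.+1)%N%:Z then s%:~R else 0).
have -> : jt_weight s c lam *: schur K n lam =
    \det (\matrix_(j, k) (w k *: jt_mx 0 0 h lam j k)).
  rewrite schur_jt -mul_mpolyC /jt_weight rmorph_prod mulrC.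
  have -> : \prod_(k < size lam) (w k)%:MP
      = \det (diag_mx (\row_k (w k)%:MP)) :> A.
    by rewrite det_diag; apply: eq_bigr => k _; rewrite mxE.
  rewrite -det_mulmx; congr (\det _); apply/matrixP=> j k.
  by rewrite mul_mx_diag !mxE mulrC mul_mpolyC.
have -> : (mdeg (part_mnm n lam))%:Z
    = \sum_(i < size lam) ((nth 0%N lam i)%:Z - i.+1%:Z + i.+1%:Z).
  rewrite mdeg_part // (big_morph Posz PoszD (erefl 0%:Z)).
  by apply: eq_bigr => i _; rewrite subrK.
apply: (approx_det (a := fun i => (nth 0%N lam i)%:Z - i.+1%:Z)
          (b := fun i => i.+1%:Z)) => j k.
rewrite !mxE mulr0z addr0.
set a := _ + k.+1%:Z; set b := _ - k.+1%:Z + c.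
have qa := approx_ext0 a qh.
rewrite /w; case: eqP => [ck|ck].
  have -> : b = a by rewrite /a /b ck; lia.
  have -> : ext0 q a + ext0 q a *~ s = (1 + s%:~R : K) *: ext0 q a.
    by rewrite scalerDl scale1r scaler_int.
  exact: approxZ.
rewrite addr0 scale1r -[X in approx _ _ X]addr0.
apply: approxD => //; split; first exact: deg_le0.
rewrite subr0 -scaler_int; apply/deg_leZ.
apply: deg_le_trans (approx_deg_le (approx_ext0 b qh)).
rewrite /a /b; lia.
Qed.

End JacobiTrudi.

(** * Bases from an alphabet *)

Section Alphabet.
Variables (K : fieldType) (n N : nat).
Local Notation A := {mpoly K[n]}.
Local Notation F := {fraction {mpoly K[n]}}.
Variables (v : 'I_N -> F) (E : {poly A}).
Hypothesis Ev :
  \prod_(i < N) (1 - (v i)%:P * 'X) = map_poly (subst (@zvar K n)) E.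
Hypothesis E_sym : E \is a polyOver (@symmetric n K).
Hypothesis E_approx : approx_poly E (\prod_(i < n) (1 - ('X_i)%:P * 'X)).

Lemma subst_hsym k : subst v (hsym K N k) = subst (@zvar K n) (inv_coef E k).
Proof.
rewrite hsym_series !rmorph_inv_coef -Ev; congr (inv_coef _ k).
rewrite rmorph_prod; apply: eq_bigr => i _ /=.
by rewrite rmorphB rmorph1 rmorphM /= map_polyC map_polyX /= subst_var.
Qed.

Lemma inv_coef_sym k : inv_coef E k \is symmetric.
Proof.
apply/polyOverP; rewrite rpred_sum // => j _.
by rewrite rpredX // rpredB // rpred1.
Qed.

(** All that matters of the alphabet is that [\prod_i (1 - v_i t)] is the image of
    a series [E] with symmetric coefficients and with the same top-degree part as
    [\prod_i (1 - X_i t)]; the scalars [t lam] normalize leading coefficients. *)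
Lemma is_basis_descent (s c : int) (t : seq nat -> K) (V : Par n -> A) :
  c <= 2 -> (forall lam, t lam * jt_weight K s c lam = 1) ->
  (forall lam : Par n,
     V lam = descent v (t lam *: \det (jt_mx s c (hsym K N) lam))) ->
  is_basis (@symmetric n K) V.
Proof.
move=> c2 tw VE.
have {}VE lam : V lam = t lam *: \det (jt_mx s c (inv_coef E) lam).
  rewrite VE; apply: descent_unique.
    by rewrite rpredZ // det_jt_sym //; apply: inv_coef_sym.
  pose z := subst (@zvar K n).
  rewrite !substZ (rmorph_det_jt s c lam subst_hsym).
  by rewrite -(rmorph_det_jt s c lam (fun k => erefl (z (inv_coef E k)))).
have lead lam : mlead (V lam) = part_mnm n lam /\ V lam != 0.
  case/andP: (par_valP lam) => /andP[slam _] le.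
  have [<- s0] := mlead_schur K slam le.
  apply: approx_mlead => //; rewrite (mlead_schur K slam le).1 VE.
  rewrite -[X in approx _ _ X]scale1r -(tw lam) -scalerA.
  apply/approxZ/approx_det_jt => // k.
  by rewrite hsym_series; apply: approx_inv_coef.
apply: is_basis_mlead => lam; [|exact: (lead lam).2|exact: (lead lam).1].
by rewrite VE rpredZ // det_jt_sym //; apply: inv_coef_sym.
Qed.

End Alphabet.

(** * The even and odd alphabets *)

Section Alphabets.
Variables (K : fieldType) (n : nat).
Local Notation A := {mpoly K[n]}.

Definition even_series : {poly A} :=
  \prod_(i < n) (1 - ('X_i)%:P * 'X + 'X^2).

Lemma inverse_pair_factor (B : comNzRingType) (a b t : B) : a * b = 1 ->
  (1 - a * t) * (1 - b * t) = 1 - (a + b) * t + t ^+ 2.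
Proof.
move=> ab; have -> : t ^+ 2 = a * b * t ^+ 2 by rewrite ab mul1r.
by ring.
Qed.

Lemma even_seriesE :
  \prod_(i < n + n) (1 - (even_alphabet K i)%:P * 'X)
    = map_poly (subst (@zvar K n)) even_series.
Proof.
rewrite big_split_ord /= -big_split rmorph_prod; apply: eq_bigr => i _ /=.
rewrite rmorphD rmorphB rmorph1 rmorphM /= map_polyC map_polyXn map_polyX /=.
rewrite subst_var /zvar polyCD /even_alphabet.
rewrite (unsplitK (inl i)) (unsplitK (inr i)).
have xx : (xvar K i)%:P * ((xvar K i)^-1)%:P = 1 :> {poly _}.
  by rewrite -polyCM divff ?xvar_neq0.
exact: inverse_pair_factor.
Qed.

Lemma even_series_sym : even_series \is a polyOver (@symmetric n K).
Proof.
apply/polyOverP => j; apply/issymP => s; rewrite -coef_map.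
suff -> : map_poly (msym s) even_series = even_series by [].
rewrite /even_series rmorph_prod /= [RHS](reindex_inj (@perm_inj _ s)) /=.
apply: eq_bigr => i _.
rewrite rmorphD rmorphB rmorph1 rmorphM /= map_polyC map_polyXn map_polyX /=.
by rewrite /msym mmapX mmap1U.
Qed.

Lemma even_series_approx :
  approx_poly even_series (\prod_(i < n) (1 - ('X_i)%:P * 'X)).
Proof.
apply: approx_poly_prod => i j; rewrite coefD coefB coefCM coefXn coefX coef1.
rewrite -[X in approx _ _ X]addr0; apply: approxD.
  apply: approx_refl; apply: deg_leD.
    by case: j => [|j] /=; [apply: (approx1 K n).1 | apply: deg_le0].
  apply: deg_leN; case: j => [|[|j]] /=; rewrite ?mulr0 ?mulr1;
    try exact: deg_le0.
  by apply: deg_leX; rewrite mdeg1.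
split; first exact: deg_le0.
case: eqP => [->|_]; rewrite subr0; last exact: deg_le0.
by apply: deg_le_trans (approx1 K n).1.
Qed.

Definition odd_series : {poly A} := even_series * (1 - 'X).

Lemma prod_adjoin_one (B : comNzRingType) m (f : 'I_(m + 1) -> B)
    (g : 'I_m -> B) : (forall i, f (lshift 1 i) = g i) -> f (rshift m ord0) = 1 ->
  \prod_(i < m + 1) (1 - (f i)%:P * 'X)
    = \prod_(i < m) (1 - (g i)%:P * 'X) * (1 - 'X).
Proof.
move=> fg f1; rewrite big_split_ord /= big_ord1 f1 polyC1 mul1r.
by congr (_ * _); apply: eq_bigr => i _; rewrite fg.
Qed.

Lemma odd_seriesE :
  \prod_(i < n + n + 1) (1 - (odd_alphabet K i)%:P * 'X)
    = map_poly (subst (@zvar K n)) odd_series.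
Proof.
rewrite rmorphM /= -even_seriesE rmorphB rmorph1 /= map_polyX.
apply: prod_adjoin_one => [i|].
  by rewrite /odd_alphabet -[lshift _ _]/(unsplit (inl _)) unsplitK.
by rewrite /odd_alphabet -[rshift _ _]/(unsplit (inr _)) unsplitK.
Qed.

Lemma odd_series_sym : odd_series \is a polyOver (@symmetric n K).
Proof.
apply/polyOverP=> i; rewrite coefM rpred_sum // => j _; rewrite rpredM //.
  by move/polyOverP: even_series_sym.
by rewrite coefB coef1 coefX rpredB // rpred_nat.
Qed.

Lemma odd_series_approx :
  approx_poly odd_series (\prod_(i < n) (1 - ('X_i)%:P * 'X)).
Proof.
rewrite -[X in approx_poly _ X]mulr1.
apply: approx_polyM; first exact: even_series_approx.
rewrite -[X in approx_poly _ X]subr0; apply: approx_polyB.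
  exact: approx_poly1.
move=> j; rewrite coef0 coefX; split; first exact: deg_le0.
case: eqP => [->|_]; rewrite subr0; last exact: deg_le0.
exact: (approx1 K n).1.
Qed.

Lemma jt_weight0 s lam : jt_weight K s 0 lam = 1.
Proof. by rewrite /jt_weight big1 // => k _; rewrite addr0. Qed.

(** The first column is doubled, unless the determinant is empty. *)
Lemma jt_weight_sp lam : (2%:R : K) != 0 ->
  (if lam is [::] then 1 else 2%:R^-1) * jt_weight K 1 2 lam = 1.
Proof.
move=> K2; case: lam => [|l lam]; first by rewrite /jt_weight big_ord0 mulr1.
rewrite /jt_weight big_ord_recl big1 /= => [|k _].
  by rewrite mulr1 mulVf.
by rewrite ifF ?addr0 //; apply/eqP; rewrite /bump; lia.
Qed.

Lemma descent_bases (N : nat) (v : 'I_N -> {fraction A}) (E : {poly A}) :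
  (2%:R : K) != 0 ->
  \prod_(i < N) (1 - (v i)%:P * 'X) = map_poly (subst (@zvar K n)) E ->
  E \is a polyOver (@symmetric n K) ->
  approx_poly E (\prod_(i < n) (1 - ('X_i)%:P * 'X)) ->
  [/\ is_basis (@symmetric n K) (fun lam : Par n => descent v (schur K N lam)),
      is_basis (@symmetric n K) (fun lam : Par n => descent v (schur_sp K N lam))
    & is_basis (@symmetric n K) (fun lam : Par n => descent v (schur_o K N lam))].
Proof.
move=> K2 Ev E_sym E_approx; split.
- apply: (is_basis_descent Ev E_sym E_approx (s := 0) (c := 0)
           (t := fun=> 1)) => // lam.
    by rewrite mul1r jt_weight0.
  by rewrite scale1r -schur_jt.
- apply: (is_basis_descent Ev E_sym E_approx (s := 1) (c := 2)
           (t := fun lam => if lam is [::] then 1 else 2%:R^-1)) => // lam.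
    exact: jt_weight_sp.
  by rewrite -schur_sp_jt.
apply: (is_basis_descent Ev E_sym E_approx (s := -1) (c := 0)
           (t := fun=> 1)) => // lam.
  by rewrite mul1r jt_weight0.
by rewrite scale1r -schur_o_jt.
Qed.

End Alphabets.

Theorem theorem1p8 (R : realType) (n : nat) (hn : (1 <= n)%N) :
  is_basis (@symmetric n R[i]) (fun lam : Par n => sz R[i] n lam) /\
  is_basis (@symmetric n R[i]) (fun lam : Par n => spz R[i] n lam) /\
  is_basis (@symmetric n R[i]) (fun lam : Par n => oz R[i] n lam) /\
  is_basis (@symmetric n R[i]) (fun lam : Par n => sz_odd R[i] n lam) /\
  is_basis (@symmetric n R[i]) (fun lam : Par n => spz_odd R[i] n lam) /\
  is_basis (@symmetric n R[i]) (fun lam : Par n => oz_odd R[i] n lam).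
Proof.
have C2 : (2%:R : R[i]) != 0 by rewrite pnatr_eq0.
have [sz_basis spz_basis oz_basis] := descent_bases C2 (even_seriesE _ n)
  (even_series_sym _ n) (even_series_approx _ n).
have [szo_basis spzo_basis ozo_basis] := descent_bases C2 (odd_seriesE _ n)
  (odd_series_sym _ n) (odd_series_approx _ n).
exact: (conj sz_basis (conj spz_basis (conj oz_basis
  (conj szo_basis (conj spzo_basis ozo_basis))))).
Qed.
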